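(* Assume that the smoothness-and-decay condition on $c_{kl}$, the taper condition, the minimal distance condition and the minimal eigenvalue condition (all stated in the context) hold. Then, as $n\to\infty$, $$\sup_{\theta\in\Theta}\bigl|L_\theta-\bar L_\theta\bigr|=o_p(1),$$ i.e. this supremum converges to $0$ in probability.
   Context: Notation. For $x\in\mathbb{R}^m$, $|x|=\max_i|x_i|$ and $\|x\|=\sqrt{\sum_i x_i^2}$. For a symmetric $N\times N$ matrix $A$, $\lambda_1(A)\ge\dots\ge\lambda_N(A)$ are its eigenvalues. $o_p(1)$ denotes a sequence of random variables converging to $0$ in probability as $n\to\infty$. The symbol $\circ$ is the entrywise (Schur) product of matrices and ${}^{\mathsf T}$ is transposition. Setting. Let $d,p,q\in\{1,2,\dots\}$ be fixed. Let $\{Z_k(s): s\in D\subset\mathbb{R}^d,\ k=1,\dots,p\}$ be a $p$-variate stationary Gaussian random process with zero mean, and $Z(s)=(Z_1(s),\dots,Z_p(s))^{\mathsf T}$. Let $\Theta=[\theta_{\inf},\theta_{\sup}]^q$ with $-\infty<\theta_{\inf}<\theta_{\sup}<+\infty$. For each $\theta\in\Theta$, $C(h;\theta)=(c_{kl}(h;\theta))_{k,l=1,\dots,p}$ is a stationary matrix covariance function on $\mathbb{R}^d$, and there exists $\theta_0\in\Theta$ with $\theta_{\inf}<\theta_{0i}<\theta_{\sup}$ for $i=1,\dots,q$ such that $C(h;\theta_0)=\mathrm{Cov}(Z(s),Z(s+h))$. Let $(t_{kl}(h))_{k,l=1,\dots,p}$ be a stationary taper matrix (covariance) function on $\mathbb{R}^d$,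 with $t_{kl}(h)=0$ for $\|h\|\ge1$. (A stationary matrix covariance function $(r_{kl})$ is one for which, for any finite set of points $y_1,\dots,y_m$, the $mp\times mp$ matrix with entries $r_{kl}(y_a-y_b)$ in row $(k,a)$ and column $(l,b)$ is symmetric and nonnegative definite.) The process is observed, all $p$ components at the same locations, at distinct points $x_1,\dots,x_n\in D$, where $(x_a)_{a\ge1}$ is a sequence in $\mathbb{R}^d$, and $n\to\infty$. Let $\gamma_n>0$ be the taper range. For $i=(k-1)n+a$ and $j=(l-1)n+b$ with $k,l\in\{1,\dots,p\}$, $a,b\in\{1,\dots,n\}$: $z$ is the $np\times1$ vector with $z_i=Z_k(x_a)$; $\Sigma_\theta$ is the $np\times np$ covariance matrix with $(i,j)$ entry $c_{kl}(x_a-x_b;\theta)$; $T$ is the $np\times np$ taper covariance matrix with $(i,j)$ entry $t_{kl}((x_a-x_b)/\gamma_n)$; and $K_\theta=\Sigma_\theta\circ T$. Define $$L_\theta=\frac1{np}\log\det\Sigma_\theta+\frac1{np}z^{\mathsf T}\Sigma_\theta^{-1}z,\qquad \bar L_\theta=\frac1{np}\log\det K_\theta+\frac1{np}z^{\mathsf T}K_\theta^{-1}z.$$ Conditions. Smoothness-and-decay condition: for all fixed $x\in\mathbb{R}^d$ and $k,l=1,\dots,p$, $c_{kl}(x;\theta)$ is continuously differentiable with respect to $\theta$ on $\Theta$, and there exist constants $A<+\infty$ and $\alpha>0$ such that for all $k,l=1,\dots,p$, $i=1,\dots,q$, $x\in\mathbb{R}^d$, $\theta\in\Theta$, $$|c_{kl}(x;\theta)|\le\frac{A}{1+|x|^{d+\alpha}},\qquad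 \Bigl|\frac{\partial}{\partial\theta_i}c_{kl}(x;\theta)\Bigr|\le\frac{A}{1+|x|^{d+\alpha}}.$$ Taper condition: for all $k,l=1,\dots,p$, $t_{kl}$ is continuous at $0$, $t_{kl}(0)=1$ and $|t_{kl}(x)|\le1$ for all $x\in\mathbb{R}^d$; and $\gamma_n\to+\infty$ as $n\to\infty$. Minimal distance condition: there exists $\Delta>0$ such that for all $n\ge1$ and all $a\ne b$ in $\{1,\dots,n\}$, $|x_a-x_b|\ge\Delta$. Minimal eigenvalue condition: there exists $\delta>0$ such that for all $n\ge1$ and all $\theta\in\Theta$, $\lambda_{np}(\Sigma_\theta)\ge\delta$ and $\lambda_{np}(K_\theta)\ge\delta$. *)

(* Defs.v *)
(* The norm `|x| of a row vector is the library's sup-norm [mx_norm]; the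
   Euclidean norm is [norm2]. *)
From HB Require Import structures.
From mathcomp Require Import all_boot all_order all_algebra.
From mathcomp Require Import all_classical all_reals all_analysis.
From mathcomp Require Import measurable_realfun mxtens.

Set Implicit Arguments.
Unset Strict Implicit.
Unset Printing Implicit Defensive.

Import Order.TTheory GRing.Theory Num.Theory.
Import numFieldTopology.Exports numFieldNormedType.Exports.

Local Open Scope classical_set_scope.
Local Open Scope ring_scope.

Definition norm2 (R : realType) (m : nat) (x : 'rV[R]_m) : R :=
  Num.sqrt (\sum_(i < m) x 0 i ^+ 2).

(* The pn x pn matrix with entry r_kl(y_a - y_b) at row k * n + a and column
   l * n + b (0-based), the index k * n + a standing for the pair (k, a);
   [mxtens_unindex] is Euclidean division by n. *)
Definition cov_mx (R : realType) (d p n : nat)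
    (r : 'rV[R]_d -> 'M[R]_p) (y : 'I_n -> 'rV[R]_d) : 'M[R]_(p * n) :=
  \matrix_(i, j) r (y (mxtens_unindex i).2 - y (mxtens_unindex j).2)
                   (mxtens_unindex i).1 (mxtens_unindex j).1.

Definition schur_mx (R : realType) (m n : nat) (A B : 'M[R]_(m, n)) :
  'M[R]_(m, n) := map2_mx *%R A B.

Definition symmetric_mx (R : realType) (n : nat) (A : 'M[R]_n) : Prop :=
  A^T = A.

Definition nonneg_definite (R : realType) (n : nat) (A : 'M[R]_n) : Prop :=
  forall v : 'cV[R]_n, 0 <= (v^T *m A *m v) 0 0.

Definition stationary_matrix_cov (R : realType) (d p : nat)
    (r : 'rV[R]_d -> 'M[R]_p) : Prop :=
  forall (m : nat) (y : 'I_m -> 'rV[R]_d),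
    symmetric_mx (cov_mx r y) /\ nonneg_definite (cov_mx r y).

(* Eigenvalues with multiplicity, in nonincreasing order.  The list is unique
   if it exists, and it exists for every symmetric matrix; it is [::] for a
   matrix whose characteristic polynomial does not split over R. *)
Definition eigenvalues (R : realType) (n : nat) (A : 'M[R]_n) : seq R :=
  xget [::] [set s : seq R | sorted >=%R s /\
                             char_poly A = \prod_(a <- s) ('X - a%:P)].

(* lambda_i(A), with i counted from 1. *)
Definition lambda (R : realType) (n : nat) (A : 'M[R]_n) (i : nat) : R :=
  nth 0 (eigenvalues A) i.-1.

Definition param_box (R : realType) (q : nat) (lo hi : R) : set 'rV[R]_q :=
  [set theta | forall i : 'I_q, lo <= theta 0 i <= hi].

(* Partial derivatives relative to a set S: the increments h are restricted to
   those for which the i-th coordinate shift stays in S, so that on a box they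
   are two-sided in the interior and one-sided on the faces. *)
Definition partial_quotient (R : realType) (q : nat) (S : set 'rV[R]_q)
    (f : 'rV[R]_q -> R) (i : 'I_q) (theta : 'rV[R]_q) : set_system R :=
  (h^-1 * (f (theta + h *: delta_mx 0 i) - f theta))
    @[h --> within [set h : R | S (theta + h *: delta_mx 0 i)] (0 : R)^'].

Definition partial_on (R : realType) (q : nat) (S : set 'rV[R]_q)
    (f : 'rV[R]_q -> R) (i : 'I_q) (theta : 'rV[R]_q) : R :=
  lim (partial_quotient S f i theta).

Definition continuously_differentiable_on (R : realType) (q : nat)
    (S : set 'rV[R]_q) (f : 'rV[R]_q -> R) : Prop :=
  forall i : 'I_q,
    (forall theta, S theta -> cvg (partial_quotient S f i theta)) /\
    {within S, continuous (partial_on S f i)}.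

(* Normal laws N(m, s^2), including the point mass at m when s = 0 (the
   library's [normal_prob m 0] is not that point mass). *)
Definition gaussian_rv (disp : measure_display) (T : measurableType disp)
    (R : realType) (P : probability T R) (X : T -> R) : Prop :=
  exists m s : R, forall B : set R, measurable B ->
    P (X @^-1` B) = if s == 0 then \d_m B else normal_prob m s B.

(* In the next definitions the values Z k s for s outside D are irrelevant. *)
Definition gaussian_process (disp : measure_display) (T : measurableType disp)
    (R : realType) (P : probability T R) (d p : nat) (D : set 'rV[R]_d)
    (Z : 'I_p -> 'rV[R]_d -> {RV P >-> R}) : Prop :=
  forall (m : nat) (s : 'I_m -> 'rV[R]_d) (k : 'I_m -> 'I_p) (u : 'I_m -> R),
    (forall j, D (s j)) ->
    gaussian_rv P (fun w => \sum_(j < m) u j * Z (k j) (s j) w).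

(* Translation invariance of the finite-dimensional laws, which are determined
   by their values on measurable rectangles. *)
Definition stationary_process (disp : measure_display)
    (T : measurableType disp) (R : realType) (P : probability T R)
    (d p : nat) (D : set 'rV[R]_d)
    (Z : 'I_p -> 'rV[R]_d -> {RV P >-> R}) : Prop :=
  forall (m : nat) (s : 'I_m -> 'rV[R]_d) (k : 'I_m -> 'I_p) (h : 'rV[R]_d)
         (B : 'I_m -> set R),
    (forall j, D (s j)) -> (forall j, D (s j + h)) ->
    (forall j, measurable (B j)) ->
    P [set w | forall j, B j (Z (k j) (s j) w)] =
    P [set w | forall j, B j (Z (k j) (s j + h) w)].

Definition zero_mean (disp : measure_display) (T : measurableType disp)
    (R : realType) (P : probability T R) (d p : nat) (D : set 'rV[R]_d)
    (Z : 'I_p -> 'rV[R]_d -> {RV P >-> R}) : Prop :=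
  forall (k : 'I_p) (s : 'rV[R]_d), D s -> 'E_P[Z k s]%E = 0%E.

(* C(h) = Cov(Z(s), Z(s + h)), i.e. C(h)_kl = Cov(Z_k(s), Z_l(s + h)). *)
Definition has_matrix_cov (disp : measure_display) (T : measurableType disp)
    (R : realType) (P : probability T R) (d p : nat) (D : set 'rV[R]_d)
    (Z : 'I_p -> 'rV[R]_d -> {RV P >-> R}) (C : 'rV[R]_d -> 'M[R]_p) : Prop :=
  forall (k l : 'I_p) (s h : 'rV[R]_d), D s -> D (s + h) ->
    covariance P (Z k s) (Z l (s + h)) = (C h k l)%:E.

(* Here and below C h theta is the matrix C(h; theta), and the location called
   x_a (a = 1, 2, ...) is x (a - 1). *)
Definition Sigma_mx (R : realType) (d p q : nat)
    (C : 'rV[R]_d -> 'rV[R]_q -> 'M[R]_p) (x : nat -> 'rV[R]_d)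
    (n : nat) (theta : 'rV[R]_q) : 'M[R]_(p * n) :=
  cov_mx (fun h => C h theta) (fun a : 'I_n => x a).

Definition taper_mx (R : realType) (d p : nat) (t : 'rV[R]_d -> 'M[R]_p)
    (gamma : nat -> R) (x : nat -> 'rV[R]_d) (n : nat) : 'M[R]_(p * n) :=
  cov_mx (fun h => t ((gamma n)^-1 *: h)) (fun a : 'I_n => x a).

Definition K_mx (R : realType) (d p q : nat)
    (C : 'rV[R]_d -> 'rV[R]_q -> 'M[R]_p) (t : 'rV[R]_d -> 'M[R]_p)
    (gamma : nat -> R) (x : nat -> 'rV[R]_d) (n : nat) (theta : 'rV[R]_q) :
    'M[R]_(p * n) :=
  schur_mx (Sigma_mx C x n theta) (taper_mx t gamma x n).

Definition obs_vec (T : Type) (R : realType) (d p : nat)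
    (Z : 'I_p -> 'rV[R]_d -> T -> R) (x : nat -> 'rV[R]_d) (n : nat) (w : T) :
    'cV[R]_(p * n) :=
  \col_i Z (mxtens_unindex i).1 (x (mxtens_unindex i).2) w.

(* (1/N) log det A + (1/N) z^T A^-1 z *)
Definition neg_loglik (R : realType) (N : nat) (A : 'M[R]_N) (z : 'cV[R]_N) : R :=
  N%:R^-1 * ln (\det A) + N%:R^-1 * (z^T *m invmx A *m z) 0 0.

Definition smooth_decay_condition (R : realType) (d p q : nat)
    (Theta : set 'rV[R]_q) (C : 'rV[R]_d -> 'rV[R]_q -> 'M[R]_p) : Prop :=
  (forall (x : 'rV[R]_d) (k l : 'I_p),
     continuously_differentiable_on Theta (fun theta => C x theta k l)) /\
  exists A alpha : R, 0 < alpha /\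
    forall (k l : 'I_p) (i : 'I_q) (x : 'rV[R]_d) (theta : 'rV[R]_q),
      Theta theta ->
      `|C x theta k l| <= A / (1 + `|x| `^ (d%:R + alpha)) /\
      `|partial_on Theta (fun theta' => C x theta' k l) i theta|
         <= A / (1 + `|x| `^ (d%:R + alpha)).

Definition taper_condition (R : realType) (d p : nat)
    (t : 'rV[R]_d -> 'M[R]_p) (gamma : nat -> R) : Prop :=
  (forall k l : 'I_p,
     [/\ {for 0, continuous (fun x => t x k l)},
         t 0 k l = 1 &
         forall x, `|t x k l| <= 1]) /\
  gamma @ \oo --> +oo.

Definition minimal_distance_condition (R : realType) (d : nat)
    (x : nat -> 'rV[R]_d) : Prop :=
  exists Delta : R, 0 < Delta /\
    forall (n : nat) (a b : 'I_n), a != b -> Delta <= `|x a - x b|.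

Definition minimal_eigenvalue_condition (R : realType) (d p q : nat)
    (Theta : set 'rV[R]_q) (C : 'rV[R]_d -> 'rV[R]_q -> 'M[R]_p)
    (t : 'rV[R]_d -> 'M[R]_p) (gamma : nat -> R) (x : nat -> 'rV[R]_d) : Prop :=
  exists delta : R, 0 < delta /\
    forall (n : nat) (theta : 'rV[R]_q), (0 < n)%N -> Theta theta ->
      delta <= lambda (Sigma_mx C x n theta) (p * n) /\
      delta <= lambda (K_mx C t gamma x n theta) (p * n).

(* X_n = o_p(1), stated in the extended reals so that a
   supremum needs no finiteness convention; the X_n are required to be random
   variables, so that the probabilities below are those of events. *)
Definition op1 (disp : measure_display) (T : measurableType disp)
    (R : realType) (P : probability T R) (X : nat -> T -> \bar R) : Prop :=
  (forall n, measurable_fun setT (X n)) /\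
  (forall eps : R, 0 < eps ->
     P [set w | (eps%:E < `|X n w|)%E] @[n --> \oo] --> 0%E).

(* Main.v *)
Require Import Defs.
From HB Require Import structures.
From mathcomp Require Import all_boot all_order all_algebra.
From mathcomp Require Import all_classical all_reals all_analysis.
From mathcomp Require Import measurable_realfun.
From mathcomp Require Import sesquilinear spectral complex ring lra.
From mathcomp Require mxtens.

Set Implicit Arguments.
Unset Strict Implicit.
Unset Printing Implicit Defensive.

Import Order.TTheory GRing.Theory Num.Theory.
Import numFieldTopology.Exports numFieldNormedType.Exports.

Local Open Scope classical_set_scope.
Local Open Scope ring_scope.

(** Write S for Sigma_theta, K for K_theta, N = pn, and let eps bound the
    absolute row sums of S - K.  Two facts give the theorem.

    First, eps can be taken to tend to 0 with n, uniformly in theta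
    ([taper_row_sum_le]).  An entry of S - K is c(h) (1 - t(h / gamma)).  The
    first factor decays like |h|^-(d + alpha).  The second is at most
    eta (1 + |h|)^(alpha/2) for large n ([taper_gap_le]): near 0 by continuity
    of t, far away because it is at most 2.  What is left of the decay,
    |h|^-(d + alpha/2), is still summable over points that are Delta apart, with
    a bound that depends neither on n nor on the points
    ([separated_decay_sum_le]).

    Secondly, S and K are symmetric with spectrum above delta, so the likelihood
    is Lipschitz in the matrix ([neg_loglik_perturb]):
      |L - Lbar| <= eps / delta + eps / delta^2 * |z|^2 / N.
    The quadratic part is z^T S^-1 (K - S) K^-1 z.  For the determinants, each
    complex eigenvalue mu of S K^-1 satisfies |mu - 1| <= eps / delta, whence
    det S <= (1 + eps / delta)^N det K, and S and K can be exchanged.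

    Hence, for every eta > 0 and all large n, the supremum over theta is at most
    eta (1 + |z|^2 / N).  The entries of z have second moments c_kk(0; theta0),
    so the mean of |z|^2 / N is bounded and the inequality of Markov concludes
    ([op1_of_dominated]).

    The supremum runs over uncountably many theta, but the log-likelihoods
    depend on theta only through finitely many real coefficients; a sequence of
    parameters whose coefficients are dense among all of them gives the same
    supremum, which is therefore a random variable
    ([measurable_sup_combination]). *)

(** * Forms and determinants of matrices close to a positive one *)

Section HermitianForms.
Local Open Scope sesquilinear_scope.

(** The Schur test: the operator norm is bounded by absolute row and column
    sums.  The inequality |a e b| <= |e| (|a|^2 + |b|^2) / 2, summed, charges
    |v_i|^2 with row i and |w_j|^2 with column j. *)
Lemma schur_test (F : numFieldType) n (E : 'M[F]_n) (eps : F) (v w : 'I_n -> F) :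
  (forall i, \sum_j `|E i j| <= eps) -> (forall j, \sum_i `|E i j| <= eps) ->
  `|\sum_i \sum_j v i * E i j * w j|
    <= eps / 2 * (\sum_i `|v i| ^+ 2 + \sum_j `|w j| ^+ 2).
Proof.
move=> rowE colE.
have amgm (a e b : F) :
    `|a * e * b| <= `|e| / 2 * `|a| ^+ 2 + `|e| / 2 * `|b| ^+ 2.
  rewrite !normrM -subr_ge0.
  have -> : `|e| / 2 * `|a| ^+ 2 + `|e| / 2 * `|b| ^+ 2 - `|a| * `|e| * `|b| =
            `|e| / 2 * (`|a| - `|b|) ^+ 2 by field.
  by rewrite mulr_ge0 ?divr_ge0 // -realEsqr realB.
rewrite (le_trans (ler_norm_sum _ _ _)) //.
apply: (@le_trans _ _ (\sum_i \sum_j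
    (`|E i j| / 2 * `|v i| ^+ 2 + `|E i j| / 2 * `|w j| ^+ 2))).
  apply: ler_sum => i _; rewrite (le_trans (ler_norm_sum _ _ _)) //.
  by apply: ler_sum => j _; apply: amgm.
under eq_bigr do rewrite big_split /=.
rewrite big_split /= [X in _ + X]exchange_big /= mulrDr !mulr_sumr.
by apply: lerD; apply: ler_sum => i _; rewrite -mulr_suml -mulr_suml;
  rewrite ler_wpM2r ?exprn_ge0 // ler_wpM2r.
Qed.

Variable C : numClosedFieldType.

Lemma sqnorm_rowE n (v : 'rV[C]_n) :
  (v *m v ^t*) 0 0 = \sum_i `|v 0 i| ^+ 2.
Proof. by rewrite mxE; apply: eq_bigr => i _; rewrite !mxE -normCK. Qed.

Lemma herm_formE n (A : 'M[C]_n) (v : 'rV[C]_n) :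
  (v *m A *m v ^t*) 0 0 = \sum_i \sum_j v 0 i * A i j * (v 0 j)^*.
Proof.
rewrite mxE exchange_big /=; apply: eq_bigr => j _.
by rewrite !mxE mulr_suml; apply: eq_bigr => i _.
Qed.

(** Diagonalise A in a unitary basis: the form becomes a sum of the squared
    moduli of the coordinates, weighted by the eigenvalues. *)
Lemma herm_form_ge n (A : 'M[C]_n) (delta : C) (v : 'rV[C]_n) :
  A \is hermsymmx -> (forall a, root (char_poly A) a -> delta <= a) ->
  delta * (v *m v ^t*) 0 0 <= (v *m A *m v ^t*) 0 0.
Proof.
move=> /hermitian_normalmx /orthomx_spectralP.
have := spectral_unitarymx A; have := spectral_unit A.
set Q := spectralmx A; set D := spectral_diag A => Qunit Quni Adiag rootA.
have D_ge i : delta <= D 0 i.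
  apply: rootA; rewrite -eigenvalue_root_char; apply/eigenvalueP.
  (* A = Q^-1 D Q, so the rows of Q are left eigenvectors of A. *)
  exists (row i Q).
    rewrite Adiag -row_mul !mulmxA mulmxV // mul1mx; apply/rowP => j.
    by rewrite !mxE (bigD1 i) //= mxE eqxx big1 ?addr0 // => k ki;
       rewrite mxE eq_sym (negbTE ki) mul0r.
  apply/eqP => Qi0; have := congr1 (fun M => row i M 0 i) (mulmxV Qunit).
  by rewrite row_mul Qi0 mul0mx !mxE eqxx => /esym/eqP; rewrite oner_eq0.
pose y := v *m invmx Q.
have yE : y ^t* = Q *m v ^t*.
  by rewrite /y trmx_mul map_mxM /= invmx_unitary // trmxCK.
have -> : v *m v ^t* = y *m y ^t* by rewrite yE mulmxA mulmxKV.
have -> : v *m A *m v ^t* = y *m diag_mx D *m y ^t*.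
  by rewrite yE Adiag !mulmxA.
rewrite sqnorm_rowE mul_mx_diag mxE mulr_sumr; apply: ler_sum => i _.
by rewrite !mxE mulrAC -normCK mulrC ler_wpM2l ?exprn_ge0.
Qed.

(** The ratio of the determinants is the product of the eigenvalues mu of
    A B^-1.  A row eigenvector v satisfies v (A - B) = (mu - 1) v B, so the two
    bounds on forms give |mu - 1| <= eps / delta.  The eigenvectors are complex
    even when A and B are real. *)
Lemma det_ratio_le n (A B : 'M[C]_n) (delta eps : C) :
  0 < delta -> 0 <= eps ->
  (forall v : 'rV_n, delta * (v *m v ^t*) 0 0 <= (v *m B *m v ^t*) 0 0) ->
  (forall v : 'rV_n,
     `|(v *m (A - B) *m v ^t*) 0 0| <= eps * (v *m v ^t*) 0 0) ->
  B \in unitmx ->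
  `|\det A| <= (1 + eps / delta) ^+ n * `|\det B|.
Proof.
move=> delta0 eps0 Bge ABle Bunit.
have -> : A = A *m invmx B *m B by rewrite mulmxKV.
set M := A *m invmx B.
rewrite det_mulmx normrM ler_wpM2r //.
have [r charM] := closed_field_poly_normal (char_poly M).
rewrite (eqP (char_poly_monic M)) scale1r in charM.
have sz_r : size r = n.
  by have := size_char_poly M; rewrite charM size_prod_XsubC => -[].
have -> : `|\det M| = \prod_(a <- r) `|a|.
  have -> : `|\det M| = `|(char_poly M).[0]|.
    by rewrite horner_coef0 char_poly_det normrM normrX normrN1 expr1n mul1r.
  rewrite charM horner_prod normr_prod; apply: eq_bigr => a _.
  by rewrite !hornerE normrN.
rewrite -sz_r -[size r]count_predT -iter_mulr_1 -big_const_seq.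
rewrite big_seq [leRHS]big_seq.
apply: ler_prod => mu mu_r; rewrite normr_ge0 /=.
have /eigenvalueP[v vM v0] : eigenvalue M mu.
  by rewrite eigenvalue_root_char charM root_prod_XsubC.
have vAB : v *m (A - B) = (mu - 1) *: (v *m B).
  rewrite mulmxBr scalerBl scale1r scalemxAl -vM /M !mulmxA mulmxKV //.
have vv0 : 0 < (v *m v ^t*) 0 0.
  rewrite sqnorm_rowE lt_neqAle sumr_ge0 ?andbT => [|i _]; last exact: exprn_ge0.
  apply: contra_neq v0 => /esym/eqP; rewrite psumr_eq0 => [|i _]; last first.
    exact: exprn_ge0.
  move=> /allP v0; apply/rowP => i; apply/eqP; rewrite mxE.
  by have := v0 i (mem_index_enum _); rewrite sqrf_eq0 normr_eq0.
have mu1 : `|mu - 1| <= eps / delta.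
  rewrite ler_pdivlMr // -(ler_pM2r vv0) -mulrA (le_trans _ (ABle v)) //.
  rewrite vAB -scalemxAl [in leRHS]mxE normrM ler_wpM2l // (le_trans (Bge v)) //.
  by rewrite real_ler_norm // ger0_real // (le_trans _ (Bge v)) // mulr_ge0 // ltW.
rewrite -[mu](subrK 1) addrC (le_trans (ler_normD _ _)) // normr1 addrC.
by rewrite [leLHS]addrC lerD2l.
Qed.

End HermitianForms.

Section RealMatrices.
Local Open Scope sesquilinear_scope.
Variable R : realType.
Local Notation C := (complex R).
Local Notation toC := (real_complex R).
Local Notation MtoC := (map_mx toC).

(** A positive lower bound on the last eigenvalue excludes the default case of
    [eigenvalues], the empty list, whose entries read as 0. *)
Lemma lambda_ge_roots n (A : 'M[R]_n) (delta : R) :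
  (0 < n)%N -> 0 < delta -> delta <= lambda A n ->
  exists2 s : seq R, char_poly A = \prod_(a <- s) ('X - a%:P) &
                     {in s, forall a, delta <= a}.
Proof.
move=> n0 delta0; rewrite /lambda /eigenvalues.
case: xgetP => [s _ [s_sorted charA]|_]; last first.
  by rewrite nth_nil leNgt delta0.
move=> delta_le; exists s => // a /(nthP 0)[i i_s <-]; apply: le_trans delta_le _.
have sz : size s = n.
  by have := size_char_poly A; rewrite charA size_prod_XsubC => -[].
apply: (sorted_leq_nth _ _ 0 s_sorted) => //.
- by move=> x y z /= xy yz; apply: le_trans yz xy.
- by move=> x; apply: lexx.
- by rewrite inE sz prednK.
- by rewrite -sz -ltnS prednK // sz.
Qed.

Lemma lambda_det_gt0 n (A : 'M[R]_n) (delta : R) :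
  (0 < n)%N -> 0 < delta -> delta <= lambda A n -> 0 < \det A.
Proof.
move=> n0 delta0 /(lambda_ge_roots n0 delta0)[s charA s_ge].
have sz : size s = n.
  by have := size_char_poly A; rewrite charA size_prod_XsubC => -[].
have -> : \det A = (-1) ^+ n * (char_poly A).[0].
  by rewrite horner_coef0 char_poly_det mulrA -exprMn mulrNN mulr1 expr1n mul1r.
rewrite charA horner_prod -sz -[size s]count_predT -iter_mulr_1 -big_const_seq.
rewrite -big_split big_seq; apply: prodr_gt0 => a /s_ge a_ge /=.
by rewrite !hornerE mulrNN mul1r (lt_le_trans delta0).
Qed.

Lemma lambda_herm_form n (A : 'M[R]_n) (delta : R) (v : 'rV[C]_n) :
  A^T = A -> (0 < n)%N -> 0 < delta -> delta <= lambda A n ->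
  toC delta * (v *m v ^t*) 0 0
    <= (v *m MtoC A *m v ^t*) 0 0.
Proof.
move=> Asym n0 delta0 /(lambda_ge_roots n0 delta0)[s charA s_ge].
apply: herm_form_ge => [|a].
  apply: realsym_hermsym.
    by apply/is_hermitianmxP; rewrite expr0 scale1r map_mx_id // map_trmx Asym.
  by apply/mxOverP => i j; rewrite mxE complex_real.
rewrite -map_char_poly charA rmorph_prod.
under eq_bigr do rewrite rmorphB /= map_polyX map_polyC /=.
rewrite -(big_map toC predT (fun b => 'X - b%:P)) root_prod_XsubC.
by move=> /mapP[b /s_ge b_ge ->]; rewrite lecR.
Qed.

Lemma lambda_form_ge n (A : 'M[R]_n) (delta : R) (v : 'rV[R]_n) :
  A^T = A -> (0 < n)%N -> 0 < delta -> delta <= lambda A n ->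
  delta * (v *m v^T) 0 0 <= (v *m A *m v^T) 0 0.
Proof.
move=> Asym n0 delta0 A_ge; have := lambda_herm_form (MtoC v) Asym n0 delta0 A_ge.
have -> : (MtoC v) ^t* = MtoC v^T.
  apply/matrixP => i j; rewrite !mxE; apply/CrealP.
  by rewrite complex_real.
by rewrite -!map_mxM /= !mxE -rmorphM lecR.
Qed.

Lemma det_perturb n (A B : 'M[R]_n) (delta eps : R) :
  A^T = A -> B^T = B -> (0 < n)%N -> 0 < delta ->
  delta <= lambda A n -> delta <= lambda B n ->
  (forall i, \sum_j `|(A - B) i j| <= eps) ->
  \det A <= (1 + eps / delta) ^+ n * \det B.
Proof.
move=> Asym Bsym n0 delta0 A_ge B_ge AB_le.
have detA0 := lambda_det_gt0 n0 delta0 A_ge.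
have detB0 := lambda_det_gt0 n0 delta0 B_ge.
have ABsym i j : (A - B) j i = (A - B) i j.
  by rewrite -[in LHS]Asym -[in LHS]Bsym !mxE.
have toC_norm (a : R) : `|toC a| = toC `|a|.
  by rewrite normc_def /= expr0n addr0 sqrtr_sqr.
have C_le i : \sum_j `|(MtoC A - MtoC B) i j| <= toC eps.
  rewrite -map_mxB; under eq_bigr do rewrite mxE toC_norm.
  by rewrite -rmorph_sum lecR.
have -> : \det A = `|\det A| by rewrite gtr0_norm.
have -> : \det B = `|\det B| by rewrite gtr0_norm.
rewrite -lecR rmorphM rmorphXn rmorphD /= fmorph_div rmorph1 -!toC_norm.
rewrite -!det_map_mx.
apply: det_ratio_le.
- by rewrite ltcR.
- rewrite (le_trans _ (C_le (Ordinal n0))) //.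
  by apply: sumr_ge0 => j _; apply: normr_ge0.
- by move=> v; apply: lambda_herm_form.
- move=> v; rewrite herm_formE sqnorm_rowE.
  apply: le_trans (schur_test (v 0) (fun j => (v 0 j)^*) C_le _) _ => [j|].
    apply: le_trans (C_le j); rewrite le_eqVlt; apply/orP; left; apply/eqP.
    by apply: eq_bigr => i _; rewrite -!map_mxB !mxE; have := ABsym i j;
       rewrite !mxE => ->.
  under [X in _ + X]eq_bigr do rewrite norm_conjC.
  by rewrite -mulr2n mulrnAr -mulrnAl -(mulr_natr _ 2) divfK // pnatr_eq0.
- by rewrite unitmxE det_map_mx unitfE fmorph_eq0 gt_eqF.
Qed.

Lemma ln_det_perturb n (A B : 'M[R]_n) (delta eps : R) :
  A^T = A -> B^T = B -> (0 < n)%N -> 0 < delta ->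
  delta <= lambda A n -> delta <= lambda B n ->
  (forall i, \sum_j `|(A - B) i j| <= eps) ->
  `|ln (\det A) - ln (\det B)| <= n%:R * (eps / delta).
Proof.
move=> Asym Bsym n0 delta0 A_ge B_ge AB_le.
have eps0 : 0 <= eps.
  rewrite (le_trans _ (AB_le (Ordinal n0))) //.
  by apply: sumr_ge0 => j _; apply: normr_ge0.
have ed0 : 0 <= eps / delta by rewrite divr_ge0 // ltW.
have ln_le (M N : R) : 0 < M -> 0 < N -> M <= (1 + eps / delta) ^+ n * N ->
    ln M - ln N <= n%:R * (eps / delta).
  move=> M0 N0 MN; rewrite lerBlDr.
  have pos : 0 < 1 + eps / delta by rewrite ltr_pwDl.
  apply: (le_trans (y := ln ((1 + eps / delta) ^+ n * N))).
    by rewrite ler_ln // posrE // mulr_gt0 // exprn_gt0.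
  rewrite lnM ?posrE ?exprn_gt0 // lerD2r lnXn // mulr_natl.
  by rewrite lerMn2r orbC le_ln1Dx // (lt_le_trans _ ed0) // ltrN10.
have detA0 := lambda_det_gt0 n0 delta0 A_ge.
have detB0 := lambda_det_gt0 n0 delta0 B_ge.
rewrite ler_norml lerNl opprB !ln_le //; first exact: det_perturb.
apply: det_perturb => // i; apply: le_trans (AB_le i).
by apply: ler_sum => j _; rewrite -opprB mxE normrN.
Qed.

(** With u = A^-1 z, the form bound gives delta |u|^2 <= u . z, and u . z is at
    most delta |u|^2 / 2 + |z|^2 / (2 delta). *)
Lemma sqnorm_invmx_le n (A : 'M[R]_n) (delta : R) (z : 'cV[R]_n) :
  A^T = A -> (0 < n)%N -> 0 < delta -> delta <= lambda A n ->
  \sum_i (invmx A *m z) i 0 ^+ 2 <= delta ^- 2 * \sum_i z i 0 ^+ 2.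
Proof.
move=> Asym n0 delta0 A_ge; set u := invmx A *m z.
have Aunit : A \in unitmx.
  by rewrite unitmxE unitfE gt_eqF // (lambda_det_gt0 n0 delta0).
have zE : z = A *m u by rewrite mulKVmx.
have := lambda_form_ge u^T Asym n0 delta0 A_ge.
rewrite trmxK -mulmxA -zE !mxE => form_ge.
have : \sum_i u i 0 * z i 0 <=
    \sum_i (delta / 2 * u i 0 ^+ 2 + (delta * 2)^-1 * z i 0 ^+ 2).
  apply: ler_sum => i _; rewrite -subr_ge0.
  have -> : delta / 2 * u i 0 ^+ 2 + (delta * 2)^-1 * z i 0 ^+ 2 - u i 0 * z i 0
     = delta / 2 * (u i 0 - z i 0 / delta) ^+ 2 by field; rewrite gt_eqF.
  by rewrite mulr_ge0 ?sqr_ge0 // divr_ge0 // ltW.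
rewrite big_split /= -!mulr_sumr.
have -> : \sum_i u i 0 * z i 0 = \sum_j u^T 0 j * z j 0.
  by apply: eq_bigr => i _; rewrite !mxE.
have E : \sum_i u i 0 ^+ 2 = \sum_j u^T 0 j * u j 0.
  by apply: eq_bigr => i _; rewrite !mxE expr2.
rewrite E; move: form_ge.
set U := \sum_j u^T 0 j * u j 0; set W := \sum_j u^T 0 j * z j 0.
set S := \sum_i z i 0 ^+ 2 => h1 h2.
rewrite -(ler_pM2l delta0).
have -> : delta * (delta ^- 2 * S) = 2 * ((delta * 2)^-1 * S).
  by field; rewrite gt_eqF.
have h3 := le_trans h1 h2; lra.
Qed.

(** The resolvent identity A^-1 - B^-1 = A^-1 (B - A) B^-1 reduces this to the
    Schur test at the vectors A^-1 z and B^-1 z. *)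
Lemma quad_invmx_perturb n (A B : 'M[R]_n) (delta eps : R) (z : 'cV[R]_n) :
  A^T = A -> B^T = B -> (0 < n)%N -> 0 < delta ->
  delta <= lambda A n -> delta <= lambda B n ->
  (forall i, \sum_j `|(A - B) i j| <= eps) ->
  `|(z^T *m invmx A *m z) 0 0 - (z^T *m invmx B *m z) 0 0|
    <= eps / delta ^+ 2 * \sum_i z i 0 ^+ 2.
Proof.
move=> Asym Bsym n0 delta0 A_ge B_ge AB_le.
have unit (M : 'M[R]_n) : delta <= lambda M n -> M \in unitmx.
  by move=> M_ge; rewrite unitmxE unitfE gt_eqF // (lambda_det_gt0 n0 delta0).
set u := invmx A *m z; set w := invmx B *m z.
have uE : u^T = z^T *m invmx A by rewrite trmx_mul trmx_inv Asym.
have eps0 : 0 <= eps.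
  rewrite (le_trans _ (AB_le (Ordinal n0))) //.
  by apply: sumr_ge0 => j _; apply: normr_ge0.
have -> : (z^T *m invmx A *m z) 0 0 - (z^T *m invmx B *m z) 0 0 =
          (u^T *m (B - A) *m w) 0 0.
  rewrite mulmxBr mulmxBl uE /w -!mulmxA !(mulKVmx (unit _ B_ge)).
  by rewrite !(mulKmx (unit _ A_ge)) !mxE.
have -> : (u^T *m (B - A) *m w) 0 0 = \sum_i \sum_j u i 0 * (B - A) i j * w j 0.
  rewrite mxE exchange_big /=; apply: eq_bigr => j _.
  by rewrite mxE mulr_suml; apply: eq_bigr => i _; rewrite [u^T 0 i]mxE.
have BA_le i : \sum_j `|(B - A) i j| <= eps.
  apply: le_trans (AB_le i); apply: ler_sum => j _.
  by rewrite -opprB mxE normrN.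
have BAsym i j : (B - A) j i = (B - A) i j.
  by rewrite -[in LHS]Asym -[in LHS]Bsym !mxE.
apply: le_trans (schur_test (u^~ 0) (w^~ 0) BA_le _) _ => [j|].
  by under eq_bigr do rewrite BAsym; apply: BA_le.
have -> : eps / delta ^+ 2 * \sum_i z i 0 ^+ 2 =
    eps / 2 * (delta ^- 2 * \sum_i z i 0 ^+ 2 + delta ^- 2 * \sum_i z i 0 ^+ 2).
  by field; rewrite gt_eqF.
rewrite ler_wpM2l ?divr_ge0 //; apply: lerD.
  under eq_bigr do rewrite real_normK ?num_real //.
  exact: sqnorm_invmx_le.
under eq_bigr do rewrite real_normK ?num_real //.
exact: sqnorm_invmx_le.
Qed.

Lemma neg_loglik_perturb n (A B : 'M[R]_n) (delta eps : R) (z : 'cV[R]_n) :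
  A^T = A -> B^T = B -> (0 < n)%N -> 0 < delta ->
  delta <= lambda A n -> delta <= lambda B n ->
  (forall i, \sum_j `|(A - B) i j| <= eps) ->
  `|neg_loglik A z - neg_loglik B z|
    <= eps / delta + eps / delta ^+ 2 * (n%:R^-1 * \sum_i z i 0 ^+ 2).
Proof.
move=> Asym Bsym n0 delta0 A_ge B_ge AB_le; rewrite /neg_loglik.
have nR : 0 < n%:R :> R by rewrite ltr0n.
rewrite opprD addrACA -!mulrBr (le_trans (ler_normD _ _)) //.
rewrite !normrM ger0_norm ?invr_ge0 // lerD //.
  by rewrite ler_pdivrMl // (ln_det_perturb _ _ _ _ A_ge B_ge).
by rewrite mulrCA ler_wpM2l ?invr_ge0 // (quad_invmx_perturb _ _ _ _ _ A_ge B_ge).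
Qed.
End RealMatrices.

(** * Decaying functions summed over separated points *)

Section Packing.
Variable R : realType.

Lemma norm_entry_le d (v : 'rV[R]_d) i : `|v 0 i| <= `|v|.
Proof. by rewrite [leRHS]mx_normrE (le_bigmax _ (fun k => `|v k.1 k.2|) (0, i)). Qed.

Lemma norm_rV_lt d (v : 'rV[R]_d) (e : R) :
  0 < e -> (forall i, `|v 0 i| < e) -> `|v| < e.
Proof.
move=> e0 v_lt; rewrite /Num.norm /=.
have [->//|/mx_norm_neq0[[i j] ->]] := eqVneq (mx_norm v) 0.
by rewrite ord1.
Qed.

(** Telescoping: (m+2)^-(1+tau) is at most 1/tau times the increment
    (m+1)^-tau - (m+2)^-tau, because expR x >= 1 + x and ln (1 + x) <= x. *)
Lemma riemann_sum_le (tau : R) J : 0 < tau ->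
  \sum_(j < J) j.+1%:R `^ (- (1 + tau)) <= 1 + tau^-1.
Proof.
move=> tau0.
have step (m : nat) : m.+2%:R `^ (- (1 + tau))
    <= tau^-1 * (m.+1%:R `^ (- tau) - m.+2%:R `^ (- tau)) :> R.
  have m2 : 0 < m.+2%:R :> R by rewrite ltr0n.
  have m1 : 0 < m.+1%:R :> R by rewrite ltr0n.
  rewrite mulrC ler_pdivlMr // lerBrDl.
  rewrite (_ : - (1 + tau) = - tau + -1) ?opprD 1?addrC // powRD; last first.
    by rewrite pnatr_eq0 implybT.
  rewrite powR_inv1 ?(ltW m2) //.
  have -> : m.+1%:R `^ (- tau) =
      m.+2%:R `^ (- tau) * (m.+1%:R / m.+2%:R) `^ (- tau) :> R.
    by rewrite -powRM ?divr_ge0 // mulrCA divff ?mulr1 // gt_eqF.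
  set u := m.+2%:R `^ (- tau); have u0 : 0 <= u by apply: powR_ge0.
  have -> : u / m.+2%:R * tau + u = u * (1 + tau / m.+2%:R).
    by field; rewrite gt_eqF.
  rewrite ler_wpM2l // /powR gt_eqF ?divr_gt0 //.
  apply: le_trans (expR_ge1Dx _); rewrite lerD2l mulNr -mulrN ler_pM2l //.
  have -> : m.+1%:R / m.+2%:R = 1 + - (m.+2%:R)^-1 :> R.
    by rewrite -[m.+1%:R](addrK 1) natr1 mulrBl divff ?gt_eqF // mul1r.
  rewrite lerNr le_ln1Dx // ltrN2 invf_lt1 // ltr1n //.
case: J => [|J]; first by rewrite big_ord0 addr_ge0 // invr_ge0 ltW.
suff: \sum_(j < J.+1) j.+1%:R `^ (- (1 + tau))
    <= 1 + tau^-1 * (1 - J.+1%:R `^ (- tau)) :> R.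
  by move=> /le_trans; apply; rewrite lerD2l ler_piMr ?invr_ge0 ?(ltW tau0) //.
elim: J => [|J IHJ]; first by rewrite big_ord1 !powR1 subrr mulr0 addr0.
rewrite big_ord_recr /=.
apply: le_trans (lerD IHJ (step J)) _.
by rewrite -addrA -mulrDr subrKA.
Qed.

(** Sort the points into cells, recording for each coordinate its sign and the
    number of whole multiples of Delta in its absolute value.  Two points in one
    cell are less than Delta apart, so no cell is used twice; the sum over all
    cells factors into d one-dimensional sums, in which each integer occurs with
    two signs.  A product of functions of the coordinates is what makes the sum
    factor. *)
Lemma packing_sum_le d n (phi : R -> R) (y : 'I_n -> 'rV[R]_d) (Delta S : R) :
  0 < Delta -> (forall r, 0 <= r -> 0 <= phi r) ->
  (forall r s, 0 <= r -> r <= s -> phi s <= phi r) ->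
  (forall J, \sum_(j < J) phi (Delta * j%:R) <= S) ->
  (forall a b, a != b -> Delta <= `|y a - y b|) ->
  \sum_b \prod_i phi `|y b 0 i| <= (S *+ 2) ^+ d.
Proof.
move=> Delta0 phi_ge0 phi_decr phi_sum y_sep.
pose m b i := Num.truncn (`|y b 0 i| / Delta).
pose J := \max_b \max_i m b i.
have m_le b i : (m b i < J.+1)%N.
  by rewrite ltnS (leq_trans _ (leq_bigmax b)) // (leq_trans _ (leq_bigmax i)).
have mP b i : Delta * (m b i)%:R <= `|y b 0 i| < Delta * (m b i).+1%:R.
  have := @truncn_itv R (`|y b 0 i| / Delta); rewrite -/(m b i).
  by rewrite divr_ge0 ?(ltW Delta0) // ler_pdivlMr // ltr_pdivrMr //
     ![_ * Delta]mulrC; apply.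
pose cell b : {ffun 'I_d -> bool * 'I_J.+1} :=
  [ffun i => (y b 0 i < 0, inord (m b i))].
have cell_inj : injective cell.
  move=> a b /ffunP ab; apply/eqP; apply: contraT => /y_sep.
  rewrite leNgt norm_rV_lt // => i.
  have := ab i; rewrite !ffunE => -[sgn /(congr1 val) /=].
  rewrite !inordK // => mab; move: sgn (mP a i) (mP b i); rewrite mab !mxE.
  rewrite -natr1 mulrDr mulr1.
  by have [] := ltrP (y a 0 i) 0; have [] := ltrP (y b 0 i) 0 => // yb ya _;
     rewrite ?(ltr0_norm ya) ?(ltr0_norm yb) ?(ger0_norm ya) ?(ger0_norm yb) =>
       /andP[? ?] /andP[? ?]; rewrite ltr_norml; apply/andP; split; lra.
pose G (f : {ffun 'I_d -> bool * 'I_J.+1}) := \prod_i phi (Delta * (f i).2%:R).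
have phi_nat (j : nat) : 0 <= phi (Delta * j%:R).
  by rewrite phi_ge0 // mulr_ge0 // ltW.
apply: (@le_trans _ _ (\sum_b G (cell b))).
  apply: ler_sum => b _; apply: ler_prod => i _; rewrite phi_ge0 //=.
  rewrite ffunE /= inordK // phi_decr //; last by case/andP: (mP b i).
  by rewrite mulr_ge0 // ltW.
rewrite -(big_imset _ (in2W cell_inj)) /=.
apply: (@le_trans _ _ (\sum_f G f)).
  rewrite big_mkcond; apply: ler_sum => f _; case: ifP => // _.
  exact: prodr_ge0.
rewrite -(bigA_distr_bigA (fun (_ : 'I_d) (s : bool * 'I_J.+1) => phi (Delta * s.2%:R))) /=.
rewrite prodr_const card_ord; apply: lerXn2r.
- by rewrite nnegrE; apply: sumr_ge0.
- rewrite nnegrE mulrn_wge0 // (le_trans _ (phi_sum 0)) // big_ord0 //.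
rewrite -(pair_bigA _ (fun (_ : bool) (s : 'I_J.+1) => phi (Delta * s%:R))) /= big_bool /=.
by rewrite mulr2n; apply: lerD; apply: phi_sum.
Qed.

Lemma powRN_decr (s a b : R) : 0 <= s -> 0 < a -> a <= b ->
  b `^ (- s) <= a `^ (- s).
Proof.
move=> s0 a0 ab; have b0 := lt_le_trans a0 ab.
rewrite !powRN lef_pV2 ?posrE ?powR_gt0 //.
by apply: ge0_ler_powR; rewrite ?nnegrE ?(ltW a0) ?(ltW b0).
Qed.

(** The sup norm dominates each coordinate, so (1 + |y|)^-(d (1+tau)) is at most
    the product of the (1 + |y_i|)^-(1+tau): the exponent d (1+tau) > d leaves
    each coordinate with an exponent above 1. *)
Lemma separated_decay_sum_le d n (y : 'I_n -> 'rV[R]_d) (Delta tau : R) :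
  0 < Delta -> Delta <= 1 -> 0 < tau ->
  (forall a b, a != b -> Delta <= `|y a - y b|) ->
  \sum_b (1 + `|y b|) `^ (- (d%:R * (1 + tau)))
    <= (Delta `^ (- (1 + tau)) * (1 + tau^-1) *+ 2) ^+ d.
Proof.
move=> Delta0 Delta1 tau0 y_sep.
have tau1 : 0 <= 1 + tau by rewrite addr_ge0 // ltW.
pose phi (r : R) := (1 + r) `^ (- (1 + tau)).
have phi_decr r s : 0 <= r -> r <= s -> phi s <= phi r.
  by move=> r0 rs; apply: powRN_decr; rewrite ?lerD2l // ltr_pwDl.
apply: le_trans (packing_sum_le (phi := phi) Delta0 _ phi_decr _ y_sep).
- apply: ler_sum => b _.
  have -> : - (d%:R * (1 + tau)) = - (1 + tau) * d%:R by rewrite mulNr mulrC.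
  rewrite powRrM powR_mulrn ?powR_ge0 // -[X in _ ^+ X]card_ord -prodr_const.
  by apply: ler_prod => i _; rewrite powR_ge0 phi_decr // norm_entry_le.
- by move=> r _; apply: powR_ge0.
- move=> J; apply: (@le_trans _ _ (\sum_(j < J)
      Delta `^ (- (1 + tau)) * j.+1%:R `^ (- (1 + tau)))).
    apply: ler_sum => j _; rewrite -powRM ?(ltW Delta0) //.
    apply: powRN_decr => //; first by rewrite mulr_gt0 // ltr0n.
    by rewrite -natr1 mulrDr mulr1 addrC lerD2r.
  by rewrite -mulr_sumr ler_wpM2l ?powR_ge0 // riemann_sum_le.
Qed.

Lemma inv_1DpowR_le (r s : R) : 0 <= r -> 0 <= s ->
  (1 + r `^ s)^-1 <= 2 `^ s * (1 + r) `^ (- s).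
Proof.
move=> r0 s0; have r1 : 0 < 1 + r by rewrite ltr_pwDl.
rewrite powRN ler_pdivlMr ?powR_gt0 // mulrC.
rewrite ler_pdivrMr ?ltr_pwDl ?powR_ge0 // mulrDr mulr1.
have le_s a b : 0 <= a -> a <= b -> a `^ s <= b `^ s.
  by move=> a0 ab; apply: ge0_ler_powR; rewrite ?nnegrE // (le_trans a0).
have [r_le1|/ltW r_ge1] := leP r 1.
  by rewrite ler_wpDr ?mulr_ge0 ?powR_ge0 // le_s ?(ltW r1) //; lra.
by rewrite -powRM // ler_wpDl ?powR_ge0 // le_s ?(ltW r1) //; lra.
Qed.
End Packing.

(** * The effect of tapering on the row sums *)

Section Tapering.
Variables (R : realType) (d p q : nat).

(** A polynomial weight makes a bound valid for all lags at once: within the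
    radius M where eta M^beta = 2, the lag h / gamma_n is small and continuity of
    the taper at 0 applies; beyond M the trivial bound 2 is enough. *)
Lemma taper_gap_le (t : 'rV[R]_d -> 'M[R]_p) (gamma : nat -> R) (beta eta : R) :
  taper_condition t gamma -> 0 < beta -> 0 < eta ->
  \forall n \near \oo, forall h k l,
    `|1 - t ((gamma n)^-1 *: h) k l| <= eta * (1 + `|h|) `^ beta.
Proof.
move=> [t_cond gamma_oo] beta0 eta0.
pose M := (2 / eta) `^ beta^-1.
have eM : eta * M `^ beta = 2.
  rewrite -powRrM mulVf ?gt_eqF // powRr1 ?divr_ge0 ?(ltW eta0) //.
  by rewrite mulrC divfK // gt_eqF.
have M0 : 0 < M by rewrite powR_gt0 // divr_gt0.
have t_near kl : \forall h \near (0 : 'rV[R]_d),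
    `|1 - t h kl.1 kl.2| <= eta.
  have [t_cont t01 _] := t_cond kl.1 kl.2.
  by have /cvgr_dist_le/(_ _ eta0) := t_cont; rewrite t01.
have := filter_forall (nbhs_filter (0 : 'rV[R]_d)) t_near.
move=> /nbhs_ballP[r /= r0 {}t_near].
have t_near_le (h : 'rV[R]_d) k l : `|h| < r -> `|1 - t h k l| <= eta.
  move=> h_r; have := t_near h; rewrite -ball_normE /= sub0r normrN.
  by move=> /(_ h_r (k, l)).
near=> n => h k l.
have gM : M / r < gamma n by near: n; apply: cvgry_gt.
have g0 : 0 < gamma n by apply: le_lt_trans gM; rewrite divr_ge0 // ltW.
have h1 : 1 <= 1 + `|h| by rewrite lerDl.
have [h_le|/ltW h_ge] := leP `|h| M.
  apply: (@le_trans _ _ eta).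
    apply: t_near_le; rewrite normrZ normfV gtr0_norm // mulrC ltr_pdivrMr //.
    by rewrite (le_lt_trans h_le) // mulrC -ltr_pdivrMr.
  rewrite ler_peMr ?(ltW eta0) // -[leLHS](powRr0 (1 + `|h|)).
  by rewrite ler_powR // ltW.
have [_ _ t_le1] := t_cond k l.
apply: (@le_trans _ _ 2).
  rewrite (le_trans (ler_normB _ _)) // normr1.
  by have := t_le1 ((gamma n)^-1 *: h); lra.
rewrite -eM ler_wpM2l ?(ltW eta0) //.
apply: ge0_ler_powR; rewrite ?nnegrE ?(ltW beta0) ?(ltW M0) //.
by rewrite (le_trans h_ge) // lerDr.
Unshelve. all: by end_near. Qed.

(** Half of the excess decay, beta = alpha / 2, pays for the weight of
    [taper_gap_le]; the other half keeps the rows summable. *)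
Lemma taper_row_sum_le (Theta : set 'rV[R]_q)
    (C : 'rV[R]_d -> 'rV[R]_q -> 'M[R]_p) (t : 'rV[R]_d -> 'M[R]_p)
    (gamma : nat -> R) (x : nat -> 'rV[R]_d) (A alpha eps : R) :
  (0 < d)%N -> 0 < alpha ->
  (forall k l h theta, Theta theta ->
     `|C h theta k l| <= A / (1 + `|h| `^ (d%:R + alpha))) ->
  taper_condition t gamma -> minimal_distance_condition x -> 0 < eps ->
  \forall n \near \oo, forall theta, Theta theta -> forall i,
    \sum_j `|(Sigma_mx C x n theta - K_mx C t gamma x n theta) i j| <= eps.
Proof.
move=> d0 alpha0 C_decay t_cond [Delta [Delta0 x_sep]] eps0.
have dR : 0 < d%:R :> R by rewrite ltr0n.
pose beta := alpha / 2; have beta0 : 0 < beta by rewrite divr_gt0.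
pose tau := beta / d%:R; have tau0 : 0 < tau by rewrite divr_gt0.
pose s := d%:R + alpha; have s0 : 0 <= s by rewrite addr_ge0 // ltW.
(* Spacing at most 1 is required below; a smaller spacing is still a valid one. *)
pose D := Num.min Delta 1.
have D0 : 0 < D by rewrite lt_min Delta0 ltr01.
have D1 : D <= 1 by rewrite ge_min lexx orbT.
pose S := (D `^ (- (1 + tau)) * (1 + tau^-1) *+ 2) ^+ d.
have S0 : 0 <= S.
  rewrite exprn_ge0 // mulrn_wge0 // mulr_ge0 ?powR_ge0 //.
  by rewrite addr_ge0 // invr_ge0 ltW.
pose B := p%:R * (`|A| * 2 `^ s * S).
have B0 : 0 <= B by rewrite !mulr_ge0 ?powR_ge0.
(* The 1 in the denominator covers the case B = 0. *)
pose eta := eps / (B + 1).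
have eta0 : 0 < eta by rewrite divr_gt0 // ltr_wpDl.
near=> n => theta Ttheta i.
have gap h k l : `|1 - t ((gamma n)^-1 *: h) k l| <= eta * (1 + `|h|) `^ beta.
  move: h k l; near: n; exact: taper_gap_le.
pose xi := x (mxtens.mxtens_unindex i).2.
have term_le k l h : `|C h theta k l - C h theta k l * t ((gamma n)^-1 *: h) k l|
    <= eta * (`|A| * 2 `^ s) * (1 + `|h|) `^ (- (d%:R * (1 + tau))).
  rewrite -{1}[C h theta k l]mulr1 -mulrBr normrM.
  have h1 : 0 < 1 + `|h| by rewrite ltr_pwDl.
  have -> : - (d%:R * (1 + tau)) = - s + beta.
    by rewrite mulrDr mulr1 mulrC divfK ?gt_eqF // /s /beta; field.
  rewrite [_ `^ (- s + _)]powRD ?(gt_eqF h1) ?implybT //.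
  have -> : eta * (`|A| * 2 `^ s) * ((1 + `|h|) `^ (- s) * (1 + `|h|) `^ beta)
    = (`|A| * (2 `^ s * (1 + `|h|) `^ (- s))) * (eta * (1 + `|h|) `^ beta).
    by ring.
  apply: ler_pM => //; rewrite (le_trans (C_decay k l h theta Ttheta)) //.
  have inv_ge0 : 0 <= (1 + `|h| `^ s)^-1 by rewrite invr_ge0 addr_ge0 ?powR_ge0.
  apply: (@le_trans _ _ (`|A| / (1 + `|h| `^ s))).
    by rewrite ler_wpM2r // ler_norm.
  by rewrite ler_wpM2l // inv_1DpowR_le.
apply: (@le_trans _ _ (\sum_(j < p * n) eta * (`|A| * 2 `^ s) *
    (1 + `|xi - x (mxtens.mxtens_unindex j).2|) `^ (- (d%:R * (1 + tau))))).
  by apply: ler_sum => j _; rewrite !mxE; apply: term_le.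
rewrite -mulr_sumr.
have -> : \sum_(j < p * n)
    (1 + `|xi - x (mxtens.mxtens_unindex j).2|) `^ (- (d%:R * (1 + tau)))
  = p%:R * \sum_(b < n) (1 + `|xi - x b|) `^ (- (d%:R * (1 + tau))).
  have := mxtens.mulr_sum (fun _ : 'I_p => 1 : R)
    (fun b : 'I_n => (1 + `|xi - x b|) `^ (- (d%:R * (1 + tau)))).
  rewrite sumr_const card_ord => ->.
  by apply: eq_bigr => j _; rewrite mul1r.
apply: (@le_trans _ _ (eta * B)).
  rewrite /B -mulrA ler_wpM2l ?(ltW eta0) // mulrCA ler_wpM2l //.
  rewrite ler_wpM2l ?mulr_ge0 ?powR_ge0 //.
  apply: (separated_decay_sum_le D0 D1 tau0) => a b ab.
  have -> : xi - x a - (xi - x b) = - (x a - x b).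
    by rewrite !opprB addrC addrA subrK.
  by rewrite normrN ge_min (x_sep n).
by rewrite mulrAC ler_pdivrMr ?ltr_wpDl // ler_wpM2l ?(ltW eps0) // lerDl.
Unshelve. all: by end_near. Qed.
End Tapering.

(** * Measurable suprema and convergence in probability *)

Section MeasurableSup.
Variable R : realType.

(** Any subset of a finite-dimensional space is separable: for each rational
    point r and each radius 1/(j+1), pick an index whose coefficients are that
    close to r, if there is one. *)
Lemma dense_sequence (I : choiceType) (K : finType) (S : set I) (a : I -> K -> R) :
  S !=set0 ->
  exists u : nat -> I, (forall n, S (u n)) /\
    forall i, S i -> forall e, 0 < e ->
      exists n, forall k, `|a i k - a (u n) k| < e.
Proof.
move=> [i0 Si0].
pose Q (rj : {ffun K -> rat} * nat) :=
  [set i | S i /\ forall k, `|a i k - ratr (rj.1 k)| < rj.2.+1%:R^-1].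
pose u (n : nat) : I :=
  if unpickle n is Some rj then xget i0 (Q rj) else i0.
exists u; split => [n|i Si e e0].
  by rewrite /u; case: unpickle => // rj; case: xgetP => [i _ []|].
have [j j_e] : exists j : nat, j.+1%:R^-1 < e / 2.
  exists (Num.truncn (e / 2)^-1).
  by rewrite invf_plt ?posrE ?divr_gt0 // truncnS_gt.
have near_rat k : exists r : rat, `|a i k - ratr r| < j.+1%:R^-1.
  have [|r] := @rat_in_itvoo R (a i k - j.+1%:R^-1) (a i k + j.+1%:R^-1).
    by rewrite ltrD2l gtrN // invr_gt0 ltr0n.
  by rewrite in_itv /= -ltr_distlC => r_near; exists r.
pose r := [ffun k => sval (cid (near_rat k))].
have Qi : Q (r, j) i.
  by split => // k; rewrite /r ffunE /=; case: cid.
exists (pickle (r, j)) => k.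
rewrite /u pickleK; case: xgetP => [i' _ [_ /(_ k) i'_near]|/(_ i)//].
have [_ /(_ k) i_near] := Qi; move: i_near i'_near j_e => /=.
rewrite !ltr_norml; set y := ratr _; set z := j.+1%:R^-1 => /andP[? ?] /andP[? ?] ?.
by apply/andP; split; lra.
Qed.

Lemma measurable_sup_combination disp (T : measurableType disp) (I : choiceType)
    (K : finType) (S : set I) (a : I -> K -> R) (F : K -> T -> R) :
  (forall k, measurable_fun setT (F k)) ->
  measurable_fun setT (fun w =>
    ereal_sup [set (`|\sum_k a i k * F k w|)%:E | i in S]).
Proof.
move=> mF; have [->|/set0P S0] := eqVneq S set0.
  by under eq_fun do rewrite image_set0 ereal_sup0; exact: measurable_cst.
have [u [Su u_dense]] := dense_sequence a S0.
pose h n w := (`|\sum_k a (u n) k * F k w|)%:E.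
rewrite (_ : (fun _ => _) = (fun w => esups (h ^~ w) 0)); last first.
  apply/funext => w; rewrite /esups /=; apply/eqP; rewrite eq_le; apply/andP; split.
    apply: ge_ereal_sup => _ [i Si <-]; apply/lee_addgt0Pr => e e0.
    pose M := \sum_k `|F k w|.
    have M0 : 0 <= M by apply: sumr_ge0.
    (* At the fixed outcome w the combination is Lipschitz in its coefficients,
       with constant M. *)
    have [|n n_near] := u_dense i Si (e / (M + 1)).
      by rewrite divr_gt0 // ltr_wpDl.
    apply: (@le_trans _ _ (h n w + e%:E)%E); last first.
      by rewrite leeD2r //; apply: ereal_sup_ubound; exists n.
    rewrite /h -EFinD lee_fin -lerBlDl (le_trans (lerB_dist _ _)) //.
    rewrite -sumrB (le_trans (ler_norm_sum _ _ _)) //.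
    apply: (@le_trans _ _ (\sum_k e / (M + 1) * `|F k w|)).
      by apply: ler_sum => k _; rewrite -mulrBl normrM ler_wpM2r // ltW.
    rewrite -mulr_sumr -/M mulrAC ler_pdivrMr ?ltr_wpDl //.
    by rewrite ler_wpM2l ?(ltW e0) // lerDl.
  by apply: ereal_sup_le => _ [n _ <-]; exists (u n).
apply: measurable_fun_esups => n; apply/measurable_EFinP.
apply: measurableT_comp => //; apply: measurable_sum => k.
by apply: measurable_funM.
Qed.
End MeasurableSup.

Section Probability.
Variables (R : realType) (disp : measure_display) (Omega : measurableType disp).
Variable P : probability Omega R.

(** Markov's inequality, with eta = e eps / (1 + B) chosen so that the bound
    eta (1 + B) / eps on the probability is e. *)
Lemma op1_of_dominated (X : nat -> Omega -> \bar R) (W : nat -> Omega -> R) (B : R) :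
  (forall n, measurable_fun setT (X n)) ->
  (forall n, measurable_fun setT (W n)) -> (forall n w, 0 <= W n w) ->
  (forall n, (\int[P]_w (W n w)%:E <= B%:E)%E) ->
  (forall eta, 0 < eta -> \forall n \near \oo,
     forall w, (`|X n w| <= (eta * (1 + W n w))%:E)%E) ->
  op1 P X.
Proof.
move=> mX mW W0 W_B X_le; split => // eps eps0.
have B0 : 0 <= B.
  rewrite -lee_fin (le_trans _ (W_B 0%N)) //.
  by apply: integral_ge0 => w _; rewrite lee_fin.
pose A n := [set w | (eps%:E < `|X n w|)%E].
have mA n : measurable (A n).
  rewrite -[A n]setTI; apply: emeasurable_fun_o_infty => //.
  exact: measurableT_comp.
apply/fine_cvgP; split; first by apply: nearW => n; apply: fin_num_measure; exact: mA.
apply/cvgrPdist_le => e e0.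
pose eta := e * eps / (1 + B).
have B1 : 0 < 1 + B by rewrite ltr_pwDl.
have eta0 : 0 < eta by rewrite divr_gt0 // mulr_gt0.
near=> n.
have Xn w : (`|X n w| <= (eta * (1 + W n w))%:E)%E.
  by move: w; near: n; exact: X_le.
have mY : measurable_fun setT (fun w => (eta * (1 + W n w))%:E).
  by apply/measurable_EFinP; apply: measurable_funM => //; apply: measurable_funD.
have Y0 w : (0 <= (eta * (1 + W n w))%:E)%E.
  by rewrite lee_fin mulr_ge0 ?(ltW eta0) // addr_ge0.
have markov_le : (eps%:E * P (A n) <= (e * eps)%:E)%E.
  rewrite -integral_cst //.
  apply: (@le_trans _ _ (\int[P]_(w in A n) (eta * (1 + W n w))%:E)%E).
    apply: ge0_le_integral => //.
    - by move=> w _; rewrite lee_fin ltW.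
    - exact: measurable_funTS.
    - by move=> w /ltW /le_trans; apply.
  apply: (@le_trans _ _ (\int[P]_w (eta * (1 + W n w))%:E)%E).
    by apply: ge0_subset_integral.
  under eq_integral do rewrite EFinM EFinD.
  rewrite ge0_integralZl_EFin ?(ltW eta0) //; last 2 first.
  - by move=> w _; rewrite -EFinD lee_fin addr_ge0.
  - by apply/measurable_EFinP; apply: measurable_funD.
  rewrite ge0_integralD //; last 2 first.
  - by move=> w _; rewrite lee_fin.
  - exact/measurable_EFinP.
  rewrite integral_cst // [X in (_ * (_ * X + _))%E](probability_setT P) mule1.
  apply: (@le_trans _ _ (eta%:E * (1 + B%:E))%E).
    by rewrite lee_pmul2l // leeD2l.
  by rewrite -EFinD -EFinM lee_fin /eta divfK // gt_eqF.
rewrite /= sub0r normrN ger0_norm ?fine_ge0 //.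
have finA : P (A n) \is a fin_num by exact: fin_num_measure.
by move: markov_le; rewrite -(fineK finA) -EFinM lee_fin mulrC ler_pM2r.
Unshelve. all: by end_near. Qed.

(** The covariance hypothesis at lag 0, where centring changes nothing. *)
Lemma second_momentE d p (D : set 'rV[R]_d) (Z : 'I_p -> 'rV[R]_d -> {RV P >-> R})
    (C : 'rV[R]_d -> 'M[R]_p) k s :
  zero_mean D Z -> has_matrix_cov D Z C -> D s ->
  (\int[P]_w (Z k s w ^+ 2)%:E = (C 0 k k)%:E)%E.
Proof.
move=> Z0 Zcov Ds; have := Zcov k k s 0; rewrite addr0 => <- //.
rewrite unlock Z0 // unlock; apply: eq_integral => w _ /=.
by rewrite mulrfctE /= subr0 expr2.
Qed.
End Probability.

(** * The two likelihoods *)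

Section Likelihood.
Variables (R : realType) (disp : measure_display) (Omega : measurableType disp).

(** The difference of two log-likelihoods is a constant plus a quadratic form in
    the observations; the index None stands for the constant term. *)
Lemma measurable_sup_neg_loglik (q N : nat) (S : set 'rV[R]_q)
    (A B : 'rV[R]_q -> 'M[R]_N) (z : Omega -> 'cV[R]_N) :
  (forall i, measurable_fun setT (fun w => z w i 0)) ->
  measurable_fun setT (fun w => ereal_sup
    [set (`|neg_loglik (A theta) (z w) - neg_loglik (B theta) (z w)|)%:E
    | theta in S]).
Proof.
move=> mz.
pose a (theta : 'rV[R]_q) (k : option ('I_N * 'I_N)) :=
  if k is Some (i, j)
  then N%:R^-1 * (invmx (A theta) i j - invmx (B theta) i j)
  else N%:R^-1 * (ln (\det (A theta)) - ln (\det (B theta))).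
pose F (k : option ('I_N * 'I_N)) w :=
  if k is Some (i, j) then z w i 0 * z w j 0 else 1.
have quadE (M : 'M[R]_N) (v : 'cV[R]_N) :
    (v^T *m M *m v) 0 0 = \sum_(ij : 'I_N * 'I_N) M ij.1 ij.2 * (v ij.1 0 * v ij.2 0).
  rewrite -(pair_bigA _ (fun i j => M i j * (v i 0 * v j 0))) /= mxE exchange_big /=.
  apply: eq_bigr => j _; rewrite mxE mulr_suml; apply: eq_bigr => i _.
  by rewrite mxE mulrAC mulrC.
have big_option (G : option ('I_N * 'I_N) -> R) :
    \sum_k G k = G None + \sum_ij G (Some ij).
  rewrite (bigD1 None) //=; congr (_ + _).
  rewrite (reindex_omap Some id) => [|[]//].
  by apply: eq_bigl => ij /=; rewrite eqxx.
have loglikE theta w : neg_loglik (A theta) (z w) - neg_loglik (B theta) (z w)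
    = \sum_k a theta k * F k w.
  rewrite big_option /= mulr1 /neg_loglik !quadE opprD addrACA -!mulrBr.
  congr (_ + _); rewrite -sumrB mulr_sumr; apply: eq_bigr => -[i j] _ /=.
  by rewrite -mulrBl mulrA.
rewrite (_ : (fun _ => _) = (fun w =>
    ereal_sup [set (`|\sum_k a theta k * F k w|)%:E | theta in S])); last first.
  apply/funext => w; congr (ereal_sup _).
  by apply: eq_imagel => theta _; rewrite loglikE.
apply: measurable_sup_combination => -[[i j]|] /=; last exact: measurable_cst.
by apply: measurable_funM.
Qed.

Lemma K_mx_sym d p q (C : 'rV[R]_d -> 'rV[R]_q -> 'M[R]_p)
    (t : 'rV[R]_d -> 'M[R]_p) gamma x n theta :
  stationary_matrix_cov (fun h => C h theta) -> stationary_matrix_cov t ->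
  (K_mx C t gamma x n theta)^T = K_mx C t gamma x n theta.
Proof.
move=> covC covt.
have [/matrixP Ssym _] := covC n (fun a => x a).
have [/matrixP Tsym _] := covt n (fun a => (gamma n)^-1 *: x a).
apply/matrixP => i j; have := Tsym i j; have := Ssym i j.
by rewrite !mxE !scalerBr => -> ->.
Qed.
End Likelihood.

Theorem theorem1 (R : realType) (disp : measure_display)
    (Omega : measurableType disp) (P : probability Omega R)
    (d p q : nat) (hd : (0 < d)%N) (hp : (0 < p)%N) (hq : (0 < q)%N)
    (D : set 'rV[R]_d) (Z : 'I_p -> 'rV[R]_d -> {RV P >-> R})
    (hgauss : gaussian_process D Z) (hstat : stationary_process D Z)
    (hmean : zero_mean D Z)
    (theta_inf theta_sup : R) (hTheta : theta_inf < theta_sup)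
    (C : 'rV[R]_d -> 'rV[R]_q -> 'M[R]_p)
    (hC : forall theta, param_box theta_inf theta_sup theta ->
            stationary_matrix_cov (fun h => C h theta))
    (theta0 : 'rV[R]_q)
    (htheta0 : forall i : 'I_q, theta_inf < theta0 0 i < theta_sup)
    (hcov : has_matrix_cov D Z (fun h => C h theta0))
    (t : 'rV[R]_d -> 'M[R]_p) (ht : stationary_matrix_cov t)
    (htsupp : forall (k l : 'I_p) (h : 'rV[R]_d), 1 <= norm2 h -> t h k l = 0)
    (x : nat -> 'rV[R]_d) (hxD : forall a, D (x a)) (hxinj : injective x)
    (gamma : nat -> R) (hgamma : forall n, (0 < n)%N -> 0 < gamma n)
    (hsmooth : smooth_decay_condition (param_box theta_inf theta_sup) C)
    (htaper : taper_condition t gamma)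
    (hdist : minimal_distance_condition x)
    (heig : minimal_eigenvalue_condition
              (param_box theta_inf theta_sup) C t gamma x) :
  op1 P (fun (n : nat) (w : Omega) =>
    ereal_sup [set (`|neg_loglik (Sigma_mx C x n theta) (obs_vec Z x n w)
                      - neg_loglik (K_mx C t gamma x n theta)
                                   (obs_vec Z x n w)|)%:E
              | theta in param_box theta_inf theta_sup]).
Proof.
have [_ [A [alpha [alpha0 C_decay]]]] := hsmooth.
have [delta [delta0 eig_ge]] := heig.
have Theta0 : param_box theta_inf theta_sup theta0.
  by move=> i; have /andP[/ltW -> /ltW ->] := htheta0 i.
have decay k l h theta : param_box theta_inf theta_sup theta ->
    `|C h theta k l| <= A / (1 + `|h| `^ (d%:R + alpha)).
  by move=> Ttheta; have [] := C_decay k l (Ordinal hq) h theta Ttheta.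
have C0_le k : C 0 theta0 k k <= `|A|.
  have r0 : 0 <= `|0 : 'rV[R]_d| `^ (d%:R + alpha) by exact: powR_ge0.
  rewrite (le_trans (ler_norm _)) // (le_trans (decay k k 0 theta0 Theta0)) //.
  rewrite ler_pdivrMr ?ltr_pwDl // (le_trans (ler_norm _)) //.
  by rewrite ler_peMr // lerDl.
pose z n w := obs_vec Z x n w.
have mz n i : measurable_fun setT (fun w => z n w i 0).
  under eq_fun do rewrite mxE; exact: measurable_funP.
pose W n w := (p * n)%:R^-1 * \sum_i z n w i 0 ^+ 2.
apply: (@op1_of_dominated _ _ _ P _ W `|A|).
- by move=> n; apply: measurable_sup_neg_loglik.
- move=> n; apply: measurable_funM => //; apply: measurable_sum => i.
  exact: measurable_funX.
- by move=> n w; rewrite mulr_ge0 ?invr_ge0 //; apply: sumr_ge0 => i _; exact: sqr_ge0.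
- move=> n; rewrite /W.
  under eq_integral do rewrite EFinM -sumEFin.
  have sq_ge0 i w : (0 <= (z n w i 0 ^+ 2)%:E)%E by rewrite lee_fin sqr_ge0.
  have msq i : measurable_fun setT (fun w => (z n w i 0 ^+ 2)%:E).
    by apply/measurable_EFinP; exact: measurable_funX.
  rewrite ge0_integralZl_EFin ?invr_ge0 //; last 2 first.
  + by move=> w _; apply: sume_ge0.
  + exact: emeasurable_sum.
  rewrite ge0_integral_sum //.
  apply: (@le_trans _ _ ((p * n)%:R^-1%:E * \sum_(i < p * n) `|A|%:E)%E).
    rewrite lee_wpmul2l ?lee_fin ?invr_ge0 //; apply: lee_sum => i _.
    under eq_integral do rewrite mxE.
    by rewrite (second_momentE _ hmean hcov) // lee_fin C0_le.
  rewrite sumEFin sumr_const card_ord -EFinM lee_fin -[`|A| *+ _]mulr_natl mulrA.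
  have [->|pn0] := eqVneq ((p * n)%:R : R) 0; first by rewrite mulr0 mul0r.
  by rewrite mulVf // mul1r.
move=> eta eta0.
pose eps := Num.min (eta * delta) (eta * delta ^+ 2).
have eps0 : 0 < eps by rewrite lt_min !mulr_gt0 // exprn_gt0.
have := taper_row_sum_le hd alpha0 decay htaper hdist eps0.
move=> row_sum; near=> n => w.
have n0 : (0 < n)%N by near: n; exact: nbhs_infty_gt.
have pn0 : (0 < p * n)%N by rewrite muln_gt0 hp.
have rows theta : param_box theta_inf theta_sup theta -> forall i,
    \sum_j `|(Sigma_mx C x n theta - K_mx C t gamma x n theta) i j| <= eps.
  by move: theta; near: n.
have W0 : 0 <= W n w.
  by rewrite mulr_ge0 ?invr_ge0 //; apply: sumr_ge0 => i _; exact: sqr_ge0.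
have diff_le theta : param_box theta_inf theta_sup theta ->
    `|neg_loglik (Sigma_mx C x n theta) (z n w)
      - neg_loglik (K_mx C t gamma x n theta) (z n w)| <= eta * (1 + W n w).
  move=> Ttheta; have [S_ge K_ge] := eig_ge n theta n0 Ttheta.
  have [Ssym _] := hC _ Ttheta _ (fun a : 'I_n => x a).
  have Ksym := K_mx_sym gamma x n (hC _ Ttheta) ht.
  apply: le_trans (neg_loglik_perturb _ Ssym Ksym pn0 delta0 S_ge K_ge
    (rows theta Ttheta)) _.
  rewrite mulrDr mulr1 lerD //.
    by rewrite ler_pdivrMr // ge_min lexx.
  by rewrite ler_wpM2r // ler_pdivrMr ?exprn_gt0 // ge_min lexx orbT.
rewrite gee0_abs; last first.
  apply: (@le_trans _ _ (`|neg_loglik (Sigma_mx C x n theta0) (z n w)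
      - neg_loglik (K_mx C t gamma x n theta0) (z n w)|)%:E).
    by rewrite lee_fin.
  by apply: ereal_sup_ubound; exists theta0.
by apply: ge_ereal_sup => _ [theta Ttheta <-]; rewrite lee_fin diff_le.
Unshelve. all: by end_near. Qed.
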